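(* With the notation of the context, let $t_i,t_{i+1}$ be two consecutive timesteps, and assume that $u\mapsto \boldsymbol{x}_\theta(u)$ is $C^2$ on the closed interval $[u_i,u_{i+1}]$ and that $v\mapsto\boldsymbol{\epsilon}_\theta(v)$ is $C^2$ on the closed interval $[v_i,v_{i+1}]$. Let $$\boldsymbol{x}^{\mathrm{exact}}_{t_{i+1}} = A\,\boldsymbol{x}_{t_i}+B\left[\int_{u_i}^{u_{i+1}}\frac{dL_{\tau_u}^{-1}(u)}{du}\,\boldsymbol{x}_\theta(u)\,du+\int_{v_i}^{v_{i+1}}\frac{dL_{\tau_v}^{-1}(v)}{dv}\,\boldsymbol{\epsilon}_\theta(v)\,dv\right]$$ be the exact update and let $$\boldsymbol{x}^{\mathrm{corr}}_{t_{i+1}} = A\,\boldsymbol{x}_{t_i}+B\Big[\boldsymbol{x}_\theta(u_i)\,\Delta L_{\tau_u}^{-1}(u_i)+\tfrac{\Delta\boldsymbol{x}_\theta(u_i)}{2}\big(\Delta L_{\tau_u}^{-1}(u_i)+K(\Delta u_i;\kappa_u)\big)+\boldsymbol{\epsilon}_\theta(v_i)\,\Delta L_{\tau_v}^{-1}(v_i)+\tfrac{\Delta\boldsymbol{\epsilon}_\theta(v_i)}{2}\big(\Delta L_{\tau_v}^{-1}(v_i)+K(\Delta v_i;\kappa_v)\big)\Big]$$ be the second-order corrector. Then $$\big\|\boldsymbol{x}^{\mathrm{exact}}_{t_{i+1}}-\boldsymbol{x}^{\mathrm{corr}}_{t_{i+1}}\big\|=\mathcal{O}\big(|\Delta u_i|^3+|\Delta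 v_i|^3\big).$$ Here the $\mathcal{O}$ means: the left side is at most $C\,(|\Delta u_i|^3+|\Delta v_i|^3)$ with a constant $C$ depending only on $\tau_u,\tau_v,\kappa_u,\kappa_v$ and on a number $M$ such that $|B|\le M$, the intervals $[u_i,u_{i+1}]$ and $[v_i,v_{i+1}]$ are contained in $[-M,M]$, and $\boldsymbol{x}_\theta(\cdot)$, $\boldsymbol{\epsilon}_\theta(\cdot)$ together with their first and second derivatives are bounded in norm by $M$ on these intervals.
   Context: Let $\alpha_t,\sigma_t>0$ be differentiable functions of time (signal rate and noise rate), and let $\gamma\in\mathbb{R}$, $\tau_u,\tau_v>0$, $\kappa_u,\kappa_v\in\mathbb{R}$ be parameters. For $\tau>0$ define the log-linear transform $L_\tau(y)=\frac{\log(1+\tau y)}{\tau}$ for $y>0$, with inverse $L_\tau^{-1}(w)=\frac{e^{\tau w}-1}{\tau}$ (this formula is used for all $w$), so $\frac{dL_\tau^{-1}(w)}{dw}=e^{\tau w}$. Define $u(t)=L_{\tau_u}(\alpha_t\sigma_t^{-\gamma})$, $v(t)=L_{\tau_v}(\sigma_t^{1-\gamma})$ if $\gamma\ge 0$, and $u(t)=L_{\tau_u}(\alpha_t^{1+\gamma})$, $v(t)=L_{\tau_v}(\sigma_t\alpha_t^{\gamma})$ if $\gamma<0$. The functions $u,v$ are taken to be invertible functions of $t$ on the relevant time range. For timesteps $t_j$ write $u_j=u(t_j)$, $v_j=v(t_j)$, $\Delta u_j=u_{j+1}-u_j$, $\Delta v_j=v_{j+1}-v_j$. Intervals $[a,b]$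 denote the closed interval with endpoints $a,b$, in whichever order. Let $\boldsymbol{x}_\theta(\boldsymbol{x},t)$ (data prediction) and $\boldsymbol{\epsilon}_\theta(\boldsymbol{x},t)$ (noise prediction) be $\mathbb{R}^d$-valued functions and $t\mapsto\boldsymbol{x}_t\in\mathbb{R}^d$ the exact sampling trajectory; write, as functions of a single scalar variable along the trajectory, $\boldsymbol{x}_\theta(u):=\boldsymbol{x}_\theta(\boldsymbol{x}_{t},t)$ with $t=u^{-1}(u)$, and $\boldsymbol{\epsilon}_\theta(v):=\boldsymbol{\epsilon}_\theta(\boldsymbol{x}_{t},t)$ with $t=v^{-1}(v)$. Further, $\Delta L_{\tau}^{-1}(w_j)=L_\tau^{-1}(w_{j+1})-L_\tau^{-1}(w_j)$, $\Delta\boldsymbol{x}_\theta(u_j)=\boldsymbol{x}_\theta(u_{j+1})-\boldsymbol{x}_\theta(u_j)$, $\Delta\boldsymbol{\epsilon}_\theta(v_j)=\boldsymbol{\epsilon}_\theta(v_{j+1})-\boldsymbol{\epsilon}_\theta(v_j)$, and $K(h;\kappa)=\kappa h^2$. The coefficients are $A=(\sigma_{t_{i+1}}/\sigma_{t_i})^{\gamma}$, $B=\sigma_{t_{i+1}}^{\gamma}$ if $\gamma\ge0$, and $A=(\alpha_{t_{i+1}}/\alpha_{t_i})^{-\gamma}$, $B=\alpha_{t_{i+1}}^{-\gamma}$ if $\gamma<0$. $\|\cdot\|$ is the Euclidean norm on $\mathbb{R}^d$. *)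

(* Defs.v *)
From HB Require Import structures.
From mathcomp Require Import all_boot all_order all_algebra.
From mathcomp Require Import all_classical all_reals all_analysis.
Set Implicit Arguments.
Unset Strict Implicit.
Unset Printing Implicit Defensive.
Import Order.TTheory GRing.Theory Num.Theory.
Import numFieldNormedType.Exports.
Local Open Scope classical_set_scope.
Local Open Scope ring_scope.

Section Defs.
Context {R : realType}.
Implicit Types (a b tau gamma kappa t w : R) (alpha sigma : R -> R).

(* The library norm `|x| on 'rV[R]_d is the sup norm, hence this definition. *)
Definition enorm d (x : 'rV[R]_d) : R := Num.sqrt (\sum_(k < d) x ord0 k ^+ 2).

Definition segment a b : set R := `[Num.min a b, Num.max a b]%classic.

(* Derivative relative to A: at an endpoint of an interval A it is the
   one-sided derivative. *)
Definition is_derive_within (V : normedModType R) (A : set R) (f : R -> V) w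
    (l : V) : Prop :=
  (z - w)^-1 *: (f z - f w) @[z --> within (A `\ w) (nbhs w)] --> l.

Definition derivable_within (V : normedModType R) (A : set R) (f : R -> V) w :
    Prop :=
  exists l : V, is_derive_within A f w l.

(* f is C^2 on A, with first and second derivatives f1 and f2. *)
Definition C2_within (V : normedModType R) (A : set R) (f f1 f2 : R -> V) :
    Prop :=
  [/\ forall w, A w -> is_derive_within A f w (f1 w),
      forall w, A w -> is_derive_within A f1 w (f2 w) &
      {within A, continuous f2}].

(* Integral from a to b, with the usual sign convention when b < a. *)
Definition oriented_integral a b (f : R -> R) : R :=
  if a <= b then \int[lebesgue_measure]_(w in `[a, b]) f w
  else - \int[lebesgue_measure]_(w in `[b, a]) f w.

Definition vector_integral d a b (f : R -> 'rV[R]_d) : 'rV[R]_d :=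
  \row_k oriented_integral a b (fun w => f w ord0 k).

Definition L tau y : R := ln (1 + tau * y) / tau.
Definition Linv tau w : R := (expR (tau * w) - 1) / tau.

Definition ufun alpha sigma gamma tau t : R :=
  if 0 <= gamma then L tau (alpha t * sigma t `^ (- gamma))
  else L tau (alpha t `^ (1 + gamma)).

Definition vfun alpha sigma gamma tau t : R :=
  if 0 <= gamma then L tau (sigma t `^ (1 - gamma))
  else L tau (sigma t * alpha t `^ gamma).

Definition coeffA alpha sigma gamma t t' : R :=
  if 0 <= gamma then (sigma t' / sigma t) `^ gamma
  else (alpha t' / alpha t) `^ (- gamma).

Definition coeffB alpha sigma gamma t' : R :=
  if 0 <= gamma then sigma t' `^ gamma else alpha t' `^ (- gamma).

(* The prediction f along the trajectory x, as a function of the variable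
   w = phi t with t in the time range T; 'pinv_ is the inverse of phi on T,
   and its default value is used only outside the image of T under phi. *)
Definition along d (f : 'rV[R]_d -> R -> 'rV[R]_d) (x : R -> 'rV[R]_d)
    (T : set R) (phi : R -> R) w : 'rV[R]_d :=
  let t := 'pinv_(fun=> 0) T phi w in f (x t) t.

Definition K h kappa : R := kappa * h ^+ 2.

Definition exact_term d tau (f : R -> 'rV[R]_d) a b : 'rV[R]_d :=
  vector_integral a b (fun w => derive1 (Linv tau) w *: f w).

Definition corr_term d tau kappa (f : R -> 'rV[R]_d) a b : 'rV[R]_d :=
  (Linv tau b - Linv tau a) *: f a +
  (Linv tau b - Linv tau a + K (b - a) kappa) *: (2^-1 *: (f b - f a)).

End Defs.

(* Main.v *)
Require Import Defs.
From HB Require Import structures.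
From mathcomp Require Import all_boot all_order all_algebra.
From mathcomp Require Import all_classical all_reals all_analysis.
From mathcomp Require Import ring.
Set Implicit Arguments.
Unset Strict Implicit.
Unset Printing Implicit Defensive.
Import Order.TTheory GRing.Theory Num.Theory.
Import numFieldNormedType.Exports.
Local Open Scope classical_set_scope.
Local Open Scope ring_scope.

(** Both the exact terms and the corrector terms change sign when the endpoints
    of the interval are exchanged, so the interval may be taken increasing.
    Testing the error vector E against itself turns the vector estimate into a
    scalar one for w |-> <f w, E>, whose derivatives are bounded by M |E| by the
    Cauchy-Schwarz inequality: this keeps the constant independent of the
    dimension.  The scalar estimate is a trapezoidal rule with exponential
    weight; the kappa term of the corrector is itself of third order, because
    the increment of f is of first order. *)

(** * Relative derivatives and the mean value theorem *)

(** The increment of [f] is [z - w], which tends to 0, times a convergent difference quotient. *)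
Lemma is_derive_within_continuous (R : realType) (V : normedModType R)
    (A : set R) (f : R -> V) w l :
  is_derive_within A f w l -> f @ within A (nbhs w) --> f w.
Proof.
move=> fl.
have id0 : (z - w) @[z --> within (A `\ w) (nbhs w)] --> (0 : R).
  rewrite -(subrr w); apply: cvg_within_filter.
  by apply: cvgB; [exact: cvg_id|exact: cvg_cst].
have fw0 : (z - w) *: ((z - w)^-1 *: (f z - f w))
    @[z --> within (A `\ w) (nbhs w)] --> (0 : V).
  by rewrite -(scale0r l); exact: cvgZ id0 fl.
apply/cvgrPdist_lt => e e0; move/cvgrPdist_lt/(_ _ e0): fw0.
rewrite !near_withinE; apply: filterS => z /= ze Az.
have [->|zw] := eqVneq z w; first by rewrite subrr normr0.
have /ze : A z /\ z <> w by split=> //; exact/eqP.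
by rewrite scalerA mulfV ?subr_eq0// scale1r sub0r opprB.
Qed.

(** Near an interior point every [z] lies in [A], so the relative quotient is the ordinary one after
    the translation [z = h + w]. *)
Lemma is_derive_within_interior (R : realType) (V : normedModType R)
    (A : set R) (f : R -> V) w l :
  A° w -> is_derive_within A f w l -> is_derive w 1 f l.
Proof.
move=> Aw fl.
have dq : (fun h : R => h^-1 *: ((f \o shift w) (h *: 1) - f w)) @ 0^' --> l.
  apply/cvgrPdist_lt => e e0; move/cvgrPdist_lt/(_ _ e0): fl.
  rewrite !near_withinE => /= fe.
  have {}fe : \forall z \near w,
      z != w -> `|l - (z - w)^-1 *: (f z - f w)| < e.
    move: fe; apply: filter_app; move: Aw; rewrite /interior /=.
    by apply: filterS => z Az ze zw; apply: ze; split=> //; exact/eqP.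
  move: fe; rewrite (near_shift 0 w) subr0; apply: filterS => h /= he h0.
  have -> : (h *: 1 : R) = h by rewrite /GRing.scale /= mulr1.
  by have := he; rewrite addrK -subr_eq0 addrK; apply.
by apply: DeriveDef; [apply/cvg_ex; exists l|exact/cvg_lim].
Qed.

(** Ordinary derivatives are required only on the open interval, where the relative ones agree with
    them; at the endpoints continuity is enough. *)
Lemma is_derive_within_mvt (R : realType) (f f1 : R -> R) (a b : R) :
  (forall w, a <= w <= b -> is_derive_within `[a, b] f w (f1 w)) ->
  forall x y, a <= x -> x <= y -> y <= b ->
  exists2 c, x <= c <= y & f y - f x = f1 c * (y - x).
Proof.
move=> fl x y ax xy yb.
have [|||c] := @MVT_segment R f f1 x y.
- exact: xy.
- move=> z; rewrite in_itv/= => /andP[xz zy].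
  apply: (@is_derive_within_interior _ _ `[a, b]); last first.
    by apply: fl; rewrite (le_trans ax) ?ltW// (lt_le_trans zy).
  apply: (@interiorS _ `]x, y[); last first.
    by apply: open_nbhs_nbhs; split; [exact: itv_open|rewrite /= in_itv/= xz].
  move=> t /=; rewrite !in_itv/= => /andP[xt ty].
  by rewrite (le_trans ax) ?ltW// (lt_le_trans ty).
- apply/subspace_continuousP => z; rewrite /= in_itv/= => /andP[xz zy].
  have : f @ within `[a, b] (nbhs z) --> f z.
    apply: is_derive_within_continuous; apply: fl.
    by rewrite (le_trans ax)// (le_trans zy).
  apply: cvg_trans; apply: cvg_app; apply: within_subset => t /=.
  rewrite !in_itv/= => /andP[xt ty].
  by rewrite (le_trans ax)// (le_trans ty).
- by rewrite in_itv/= => cxy e; exists c.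
Qed.

(** Assuming the mean value property, rather than one kind of derivative, serves both the relative
    derivatives of the prediction and the ordinary derivative of the exponential. *)
Lemma mvt_lipschitz (R : realType) (f f1 : R -> R) (a b N : R) :
  (forall x y, a <= x -> x <= y -> y <= b ->
    exists2 c, x <= c <= y & f y - f x = f1 c * (y - x)) ->
  (forall w, a <= w <= b -> `|f1 w| <= N) ->
  forall x y, a <= x <= b -> a <= y <= b -> `|f x - f y| <= N * (b - a).
Proof.
move=> mvt f1N x y; wlog xy : x y / x <= y.
  by move=> wl; have [/wl//|/ltW yx] := leP x y => xab yab; rewrite distrC wl.
move=> /andP[ax xb] /andP[ay yb].
have [c /andP[xc cy] fc] := mvt x y ax xy yb.
rewrite distrC fc normrM; apply: ler_pM => //.
  by apply: f1N; rewrite (le_trans ax xc) (le_trans cy yb).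
by rewrite ger0_norm ?subr_ge0// lerB.
Qed.

(** * Euclidean inner product and norm *)

Definition dot (R : realType) d (x y : 'rV[R]_d) : R :=
  \sum_(k < d) x ord0 k * y ord0 k.

Lemma enorm_ge0 (R : realType) d (x : 'rV[R]_d) : 0 <= enorm x.
Proof. exact: sqrtr_ge0. Qed.

Lemma sqr_enorm (R : realType) d (x : 'rV[R]_d) : enorm x ^+ 2 = dot x x.
Proof. by rewrite sqr_sqrtr//; apply: sumr_ge0 => k _; exact: sqr_ge0. Qed.

(** The squared norm of [Y x - P y] equals [Y (X Y - P^2)]. Divide by [Y] if it is positive;
    otherwise [y], hence [P], vanishes. *)
Lemma cauchy_schwarz (R : realType) d (x y : 'rV[R]_d) :
  `|dot x y| <= enorm x * enorm y.
Proof.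
rewrite /dot /enorm.
set X := \sum_(k < d) x _ _ ^+ 2; set Y := \sum_(k < d) y _ _ ^+ 2.
set P := \sum_(k < d) _.
have X0 : 0 <= X by apply: sumr_ge0 => k _; exact: sqr_ge0.
have Y0 : 0 <= Y by apply: sumr_ge0 => k _; exact: sqr_ge0.
have : 0 <= Y * (X * Y - P ^+ 2).
  have <- : \sum_(k < d) (Y * x ord0 k - P * y ord0 k) ^+ 2
      = Y * (X * Y - P ^+ 2).
    rewrite (eq_bigr (fun k => Y ^+ 2 * x ord0 k ^+ 2
      + (P ^+ 2 * y ord0 k ^+ 2 - 2 * P * Y * (x ord0 k * y ord0 k)))); last first.
      by move=> k _; ring.
    rewrite !big_split/= sumrN -!mulr_sumr -/X -/Y -/P; ring.
  by apply: sumr_ge0 => k _; exact: sqr_ge0.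
rewrite -sqrtrM// -sqrtr_sqr => h; apply: ler_wsqrtr.
move: Y0; rewrite le_eqVlt => /predU1P[Y0|Y0]; last first.
  by move: h; rewrite pmulr_rge0// subr_ge0.
suff -> : P = 0 by rewrite expr0n -Y0 mulr0.
apply: big1 => k _.
move/eqP : Y0; rewrite eq_sym psumr_eq0; last by move=> ? _; exact: sqr_ge0.
move/allP => /(_ k (mem_index_enum _)); rewrite sqrf_eq0 => /eqP ->.
by rewrite mulr0.
Qed.

(** Compare squares: the cross term is bounded by Cauchy-Schwarz. *)
Lemma enormD (R : realType) d (x y : 'rV[R]_d) :
  enorm (x + y) <= enorm x + enorm y.
Proof.
rewrite -(@ler_pXn2r _ 2)// ?nnegrE ?addr_ge0 ?enorm_ge0//.
have h := le_trans (ler_norm _) (cauchy_schwarz x y).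
have -> : enorm (x + y) ^+ 2 = dot x x + 2 * dot x y + dot y y.
  rewrite sqr_enorm /dot mulr_sumr -!big_split/=.
  by apply: eq_bigr => k _; rewrite mxE; ring.
by rewrite sqrrD !sqr_enorm lerD2r lerD2l -[leRHS]mulr_natl ler_pM2l.
Qed.

Lemma enormZ (R : realType) d (c : R) (x : 'rV[R]_d) :
  enorm (c *: x) = `|c| * enorm x.
Proof.
rewrite /enorm -sqrtr_sqr -sqrtrM ?sqr_ge0// mulr_sumr; congr Num.sqrt.
by apply: eq_bigr => k _; rewrite mxE exprMn.
Qed.

(** * Trapezoidal rule with a weight *)

(* The x-derivative of [int_a^x g f - (G x - G a) (f a + f x) / 2] is
   [(g x (f x - f a) - (G x - G a) f' x) / 2], and the two products agree up
   to O((x - a)^2) by the mean value theorem. *)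
Lemma weighted_trapezoid (R : realType) (G g f f1 : R -> R) (a b P Q N1 N2 : R) :
  a <= b ->
  (forall x : R, is_derive x 1 G (g x)) ->
  continuous g ->
  (forall w, a <= w <= b -> is_derive_within `[a, b] f w (f1 w)) ->
  (forall w, a <= w <= b -> `|g w| <= P) ->
  (forall x y, a <= x <= b -> a <= y <= b -> `|g x - g y| <= Q * (b - a)) ->
  (forall w, a <= w <= b -> `|f1 w| <= N1) ->
  (forall x y, a <= x <= b -> a <= y <= b -> `|f1 x - f1 y| <= N2 * (b - a)) ->
  `|\int[lebesgue_measure]_(w in `[a, b]) (g w * f w)
    - (G b - G a) * ((f a + f b) / 2)|
   <= (P * N2 + N1 * Q) / 2 * (b - a) ^+ 3.
Proof.
move=> ab dG cg df gP gQ f1N1 f1N2.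
have aab : a <= a <= b by rewrite lexx.
have cf : {within `[a, b], continuous f}.
  apply/subspace_continuousP => z; rewrite /= in_itv/= => zab.
  by apply: is_derive_within_continuous; exact: df.
have cgf : {within `[a, b], continuous (fun w => g w * f w)}.
  apply/subspace_continuousP => z zab; apply: cvgM.
    by apply: cvg_within_filter; exact: cg.
  by move/subspace_continuousP : cf; exact.
have cG : continuous G.
  by move=> z; apply/differentiable_continuous/derivable1_diffP; have [] := dG z.
have igf : lebesgue_measure.-integrable `[a, b] (EFin \o (fun w => g w * f w)).
  by apply: continuous_compact_integrable => //; exact: segment_compact.
(* [F x] is the quadrature error on [[a, x]]. It vanishes at [a], so a quadratic bound on its
   derivative [dF] gives a cubic bound on [F b]. *)
pose I x := \int[lebesgue_measure]_(w in `[a, x]) (g w * f w).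
pose F x := I x - (G x - G a) * ((f a + f x) / 2).
pose dF x := g x * f x - (g x * ((f a + f x) / 2) + (G x - G a) * (f1 x / 2)).
have Fa : F a = 0.
  by rewrite /F /I subrr mul0r subr0 set_itv1 Rintegral_set1.
have cF : {within `[a, b], continuous F}.
  apply/subspace_continuousP => z zab.
  apply: cvgB.
    have := parameterized_integral_continuous ab igf.
    by move/subspace_continuousP; exact.
  apply: cvgM.
    apply: cvgB; last exact: cvg_cst.
    by apply: cvg_within_filter; exact: cG.
  apply: cvgMr_tmp; apply: cvgD; first exact: cvg_cst.
  by move/subspace_continuousP : cf; exact.
have ddF (x : R) : x \in `]a, b[ -> is_derive x 1 F (dF x).
  move=> xab; move: (xab); rewrite in_itv/= => /andP[ax xb].
  have dfx : is_derive x 1 f (f1 x).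
    apply: (@is_derive_within_interior _ _ `[a, b]).
      by apply: (@interiorS _ `]a, b[);
        [exact: subset_itv_oo_cc|apply: open_nbhs_nbhs; split; [exact: itv_open|]].
    by apply: df; rewrite !ltW.
  (* Fundamental theorem of calculus at an interior point, where the integrand is continuous. *)
  have dI : is_derive x 1 I (g x * f x).
    have [] := continuous_FTC1_closed xb igf ax.
      exact: (within_continuous_continuous (lt_trans ax xb) cgf).
    by move=> dI vI; apply: DeriveDef => //; rewrite -derive1E.
  have dJ := is_deriveB (dG x) (is_derive_cst (G a) x 1).
  have dm := is_deriveZ 2^-1 (is_deriveD (is_derive_cst (f a) x 1) dfx).
  have := is_deriveB dI (is_deriveM dJ dm).
  have -> : I - (G - cst (G a)) * (2^-1 \*: (cst (f a) + f)) = F.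
    by apply/funext => z; rewrite /F [in RHS](mulrC _ 2^-1).
  move=> h; apply: (is_derive_eq h).
  by rewrite /dF !fctE /= /GRing.scale /=; field.
have dFb x : a <= x <= b ->
    `|dF x| <= (P * N2 + N1 * Q) / 2 * (b - a) ^+ 2.
  move=> /andP[ax xb].
  have xab : a <= x <= b by rewrite ax.
  have [c /andP[ac cx] fc] := is_derive_within_mvt df (lexx a) ax xb.
  have [e] := @MVT_segment R G g a x ax (fun z _ => dG z)
    (continuous_subspaceT cG).
  rewrite in_itv/= => /andP[ae ex] Ge.
  have cab : a <= c <= b by rewrite ac (le_trans cx).
  have eab : a <= e <= b by rewrite ae (le_trans ex).
  (* Here [f x - f a] is [f1 c * (x - a)] and [G x - G a] is [g e * (x - a)]; the term [g x * f1 x]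
     is added and subtracted. *)
  have -> : dF x = (x - a) / 2 * (g x * (f1 c - f1 x) + f1 x * (g x - g e)).
    rewrite /dF Ge; have -> : f x = f a + f1 c * (x - a) by rewrite -fc; ring.
    by field.
  rewrite normrM ger0_norm ?divr_ge0 ?subr_ge0//.
  have -> : (P * N2 + N1 * Q) / 2 * (b - a) ^+ 2 =
     (b - a) / 2 * (P * (N2 * (b - a)) + N1 * (Q * (b - a))) by field.
  apply: ler_pM; rewrite ?divr_ge0 ?subr_ge0//.
    by rewrite ler_pM2r ?invr_gt0// lerD2r.
  apply: (le_trans (ler_normD _ _)); rewrite !normrM.
  by apply: lerD; apply: ler_pM => //; [exact: gP|exact: f1N2|exact: f1N1|exact: gQ].
have [c] := MVT_segment ab ddF cF.
rewrite in_itv/= Fa subr0 => /dFb dFc Fb.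
rewrite -[X in `|X|]/(F b) Fb normrM (ger0_norm (_ : 0 <= b - a)) ?subr_ge0//.
by rewrite [in leRHS]exprSr mulrA ler_wpM2r// subr_ge0.
Qed.

(** * Linearity and continuity of the inner product *)

Lemma dotBl (R : realType) d (x z y : 'rV[R]_d) :
  dot (x - z) y = dot x y - dot z y.
Proof.
rewrite /dot -sumrB; apply: eq_bigr => k _.
by rewrite !mxE mulrBl.
Qed.

Lemma dotDl (R : realType) d (x z y : 'rV[R]_d) :
  dot (x + z) y = dot x y + dot z y.
Proof.
by rewrite /dot -big_split/=; apply: eq_bigr => k _; rewrite mxE mulrDl.
Qed.

Lemma dotZl (R : realType) d c (x y : 'rV[R]_d) : dot (c *: x) y = c * dot x y.
Proof.
by rewrite /dot mulr_sumr; apply: eq_bigr => k _; rewrite mxE mulrA.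
Qed.

Lemma dot_continuous (R : realType) d (y : 'rV[R]_d) :
  continuous (fun x : 'rV[R]_d => dot x y).
Proof.
apply: continuous_big; first exact: add_continuous.
move=> k _ x; apply: (@cvgMr_tmp _ _ (nbhs x)).
exact: (@coord_continuous _ _ _ ord0 k x).
Qed.

(** By linearity the quotient of the pairing is the pairing of the quotient; continuity passes to
    the limit. *)
Lemma is_derive_within_dot (R : realType) d (A : set R) (f : R -> 'rV[R]_d)
    w l (y : 'rV[R]_d) :
  is_derive_within A f w l -> is_derive_within A (fun z => dot (f z) y) w (dot l y).
Proof.
move=> fl; rewrite /is_derive_within.
under eq_fun do rewrite -dotBl /GRing.scale/= -dotZl.
exact: (cvg_comp _ _ fl (@dot_continuous _ _ y l)).
Qed.

(** * The exponential weight and its primitive [Linv] *)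

Lemma is_derive_expRM (R : realType) (tau w : R) :
  is_derive w 1 (fun z : R => expR (tau * z)) (tau * expR (tau * w)).
Proof.
have dt : is_derive w 1 (fun z : R => tau * z) tau.
  apply: (is_derive_eq (is_deriveZ tau (is_derive_id w (1 : R)))).
  by rewrite /GRing.scale/= mulr1.
by apply: (is_derive_eq (is_derive1_comp (is_derive_expR _) dt)); rewrite mulrC.
Qed.

Lemma is_derive_Linv (R : realType) (tau w : R) : tau != 0 ->
  is_derive w 1 (Linv tau) (expR (tau * w)).
Proof.
move=> tau0.
have := is_deriveZ tau^-1
  (is_deriveB (is_derive_expRM tau w) (is_derive_cst (1 : R) w (1 : R))).
have -> : tau^-1 \*: ((fun z : R => expR (tau * z)) - cst 1) = Linv tau.
  by apply/funext => z; rewrite /Linv [in RHS]mulrC.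
by move=> h; apply: (is_derive_eq h); rewrite /GRing.scale/=; field.
Qed.

Lemma continuous_expRM (R : realType) (tau : R) :
  continuous (fun w : R => expR (tau * w)).
Proof.
by move=> w; apply: continuous_comp;
  [apply: cvgMl_tmp; exact: cvg_id|exact: continuous_expR].
Qed.

(** * Pairing a vector integral with a fixed vector *)

Lemma Rintegral_sum (R : realType) d (T : measurableType d)
    (mu : {measure set T -> \bar R}) (D : set T) I (s : seq I) (f : I -> T -> R) :
  measurable D -> (forall i, mu.-integrable D (EFin \o f i)) ->
  \int[mu]_(x in D) (\sum_(i <- s) f i x) = \sum_(i <- s) \int[mu]_(x in D) f i x.
Proof.
move=> mD fi; elim: s => [|i s ih].
  under eq_Rintegral do rewrite big_nil.
  by rewrite big_nil Rintegral_cst// mul0r.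
under eq_Rintegral do rewrite big_cons.
rewrite big_cons RintegralD// ?ih//.
have := integrable_sum mD s (P := xpredT) (fun i _ => fi i).
by apply: eq_integrable => // x _; rewrite /= sumEFin.
Qed.

(** The vector integral is coordinatewise, so the finite sum over coordinates moves inside;
    continuity of [f] makes each coordinate integrable. *)
Lemma dot_exact_term (R : realType) d (tau : R) (f : R -> 'rV[R]_d) (a b : R) y :
  tau != 0 -> a <= b ->
  (forall w, a <= w <= b -> f @ within `[a, b] (nbhs w) --> f w) ->
  dot (exact_term tau f a b) y =
  \int[lebesgue_measure]_(w in `[a, b]) (expR (tau * w) * dot (f w) y).
Proof.
move=> tau0 ab cf.
have int_k k : lebesgue_measure.-integrable `[a, b]
    (EFin \o (fun w => expR (tau * w) * f w ord0 k)).
  apply: continuous_compact_integrable; first exact: segment_compact.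
  apply/subspace_continuousP => w; rewrite /= in_itv/= => wab.
  apply: cvgM; first by apply: cvg_within_filter; exact: continuous_expRM.
  by exact: (cvg_comp _ _ (cf _ wab) (@coord_continuous _ _ _ ord0 k _)).
have fE : forall w, expR (tau * w) * dot (f w) y =
    \sum_(k < d) y ord0 k * (expR (tau * w) * f w ord0 k).
  by move=> w; rewrite /dot mulr_sumr; apply: eq_bigr => k _; ring.
under eq_Rintegral do rewrite fE.
rewrite Rintegral_sum//; last first.
  move=> k; have := integrableZl (mu := lebesgue_measure) (measurable_itv `[a, b])
    (y ord0 k) (int_k k).
  by apply: eq_integrable => // x _ /=; rewrite EFinM.
apply: eq_bigr => k _; rewrite mxE /oriented_integral ab mulrC.
rewrite RintegralZl//; congr (_ * _); apply: eq_Rintegral => w _.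
by rewrite mxE derive1E (derive_val (is_derive := is_derive_Linv w tau0)).
Qed.

(** * Exchange of the endpoints *)

Lemma segmentC (R : realType) (a b : R) : segment a b = segment b a.
Proof. by rewrite /segment minC maxC. Qed.

(** Strictness sends the two orders to different branches of [oriented_integral]. *)
Lemma exact_termC (R : realType) d tau (f : R -> 'rV[R]_d) a b :
  a < b -> exact_term tau f b a = - exact_term tau f a b.
Proof.
move=> ab; apply/rowP => k; rewrite !mxE /oriented_integral.
by rewrite leNgt ab (ltW ab).
Qed.

(** The [Linv] increment multiplies the symmetric mean of [f a] and [f b], while the even [K]
    multiplies their odd difference. *)
Lemma corr_termC (R : realType) d tau kappa (f : R -> 'rV[R]_d) a b :
  corr_term tau kappa f b a = - corr_term tau kappa f a b.
Proof. by apply/rowP => k; rewrite !mxE /K; field. Qed.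

(** * Error of one term *)

Lemma term_error (R : realType) d (tau kappa M : R) (f f1 f2 : R -> 'rV[R]_d) a b :
  0 < tau -> 0 <= M ->
  C2_within (segment a b) f f1 f2 ->
  segment a b `<=` `[- M, M] ->
  (forall w, segment a b w -> enorm (f1 w) <= M /\ enorm (f2 w) <= M) ->
  enorm (exact_term tau f a b - corr_term tau kappa f a b) <=
  (expR (tau * M) * (1 + tau) + `|kappa|) / 2 * M * `|b - a| ^+ 3.
Proof.
move=> tau0 M0.
wlog ab : a b / a <= b.
  move=> wl; have [/wl//|ba] := leP a b.
  rewrite segmentC => ? ? ?.
  rewrite exact_termC// corr_termC -opprD -scaleN1r enormZ normrN1 mul1r distrC.
  by apply: wl => //; exact: ltW.
have -> : segment a b = `[a, b]%classic by rewrite /segment min_l// max_r.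
case=> df df1 _ abM fM.
have {}df w : a <= w <= b -> is_derive_within `[a, b] f w (f1 w).
  by move=> wab; apply: df; rewrite /= in_itv.
have {}df1 w : a <= w <= b -> is_derive_within `[a, b] f1 w (f2 w).
  by move=> wab; apply: df1; rewrite /= in_itv.
have f1M w : a <= w <= b -> enorm (f1 w) <= M.
  by move=> wab; apply: (fM w _).1; rewrite /= in_itv.
have f2M w : a <= w <= b -> enorm (f2 w) <= M.
  by move=> wab; apply: (fM w _).2; rewrite /= in_itv.
have {}abM w : a <= w <= b -> w <= M.
  move=> wab; have /abM : `[a, b]%classic w by [].
  by rewrite /= in_itv/= => /andP[].
set E := _ - _; set e := enorm E.
have e0 : 0 <= e by exact: enorm_ge0.
pose g w := expR (tau * w).
pose phi w := dot (f w) E; pose phi1 w := dot (f1 w) E.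
pose phi2 w := dot (f2 w) E.
have dphi w : a <= w <= b -> is_derive_within `[a, b] phi w (phi1 w).
  by move=> wab; apply: is_derive_within_dot; exact: df.
have dphi1 w : a <= w <= b -> is_derive_within `[a, b] phi1 w (phi2 w).
  by move=> wab; apply: is_derive_within_dot; exact: df1.
have phi1M w : a <= w <= b -> `|phi1 w| <= M * e.
  move=> wab; apply: (le_trans (cauchy_schwarz _ _)).
  by apply: ler_wpM2r => //; exact: f1M.
have phi2M w : a <= w <= b -> `|phi2 w| <= M * e.
  move=> wab; apply: (le_trans (cauchy_schwarz _ _)).
  by apply: ler_wpM2r => //; exact: f2M.
have gP w : a <= w <= b -> `|g w| <= expR (tau * M).
  by move=> /abM wM; rewrite ger0_norm ?expR_ge0// ler_expR ler_pM2l.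
have gQ : forall x y, a <= x <= b -> a <= y <= b ->
    `|g x - g y| <= tau * expR (tau * M) * (b - a).
  apply: (@mvt_lipschitz _ g (fun w => tau * g w)) => [x y _ xy _|w wab].
    have [c] := MVT_segment xy (fun z _ => is_derive_expRM tau z)
      (continuous_subspaceT (@continuous_expRM _ tau)).
    by rewrite in_itv/=; exists c.
  by rewrite normrM (gtr0_norm tau0) ler_pM2l// gP.
have phi1L := mvt_lipschitz (is_derive_within_mvt dphi1) phi2M.
have tz := weighted_trapezoid ab (fun w => is_derive_Linv w (lt0r_neq0 tau0))
  (@continuous_expRM _ tau) dphi gP gQ phi1M phi1L.
have dphiab : `|phi b - phi a| <= M * e * (b - a).
  by apply: (mvt_lipschitz (is_derive_within_mvt dphi) phi1M); rewrite lexx ab.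
(* The corrector regrouped: trapezoidal rule for [phi] plus the [kappa] term. *)
have EE : dot E E = \int[lebesgue_measure]_(w in `[a, b]) (g w * phi w)
    - (Linv tau b - Linv tau a) * ((phi a + phi b) / 2)
    - kappa * (b - a) ^+ 2 * ((phi b - phi a) / 2).
  rewrite {1}/E dotBl dot_exact_term ?lt0r_neq0//; last first.
    by move=> w /df; exact: is_derive_within_continuous.
  by rewrite /corr_term dotDl !dotZl dotBl -/(phi a) -/(phi b) /K; field.
have h0 : 0 <= b - a by rewrite subr_ge0.
(* The trapezoidal bound enters with [P = expR (tau * M)], [Q = tau * P] and [N1 = N2 = M * e]; the
   last two supply the factor [e] to be cancelled. *)
have : e ^+ 2 <=
    (expR (tau * M) * (1 + tau) + `|kappa|) / 2 * M * (b - a) ^+ 3 * e.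
  rewrite sqr_enorm EE; apply: (le_trans (ler_norm _)).
  apply: (le_trans (ler_normB _ _)).
  apply: (le_trans (lerD tz (lexx _))).
  have : `|kappa * (b - a) ^+ 2 * ((phi b - phi a) / 2)| <=
      `|kappa| * (b - a) ^+ 2 * (M * e * (b - a) / 2).
    have := exprn_ge0 2 h0; move: ((b - a) ^+ 2) => h2 h20.
    rewrite !normrM (ger0_norm h20) (@ger0_norm _ 2^-1)//.
    apply: ler_wpM2l; first by rewrite mulr_ge0.
    by rewrite ler_pM2r ?invr_gt0.
  move=> kb; apply: (le_trans (lerD (lexx _) kb)).
  by rewrite le_eqVlt; apply/orP; left; apply/eqP; field.
rewrite (ger0_norm h0) expr2.
(* When [e] is 0 nothing can be cancelled, but the right side is nonnegative. *)
have [->|en0] := eqVneq e 0; last by rewrite ler_pM2r// lt_def en0.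
move=> _; rewrite !mulr_ge0 ?exprn_ge0// addr_ge0// mulr_ge0 ?expR_ge0//.
by rewrite addr_ge0// ltW.
Qed.

(** * Combination of the two terms *)

Theorem theoremC3 (R : realType) (tau_u tau_v kappa_u kappa_v M : R)
    (tau_u_gt0 : 0 < tau_u) (tau_v_gt0 : 0 < tau_v) :
  exists C : R,
  forall (d : nat) (alpha sigma : R -> R) (gamma : R) (T : set R)
    (x_theta eps_theta : 'rV[R]_d -> R -> 'rV[R]_d) (x : R -> 'rV[R]_d)
    (t : nat -> R) (i : nat) (xu1 xu2 ev1 ev2 : R -> 'rV[R]_d),
  let u := ufun alpha sigma gamma tau_u in
  let v := vfun alpha sigma gamma tau_v in
  let ui := u (t i) in let ui1 := u (t i.+1) in
  let vi := v (t i) in let vi1 := v (t i.+1) in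
  let xu := along x_theta x T u in
  let ev := along eps_theta x T v in
  let A := coeffA alpha sigma gamma (t i) (t i.+1) in
  let B := coeffB alpha sigma gamma (t i.+1) in
  is_interval T ->
  (forall s, T s -> 0 < alpha s /\ 0 < sigma s) ->
  (forall s, T s -> derivable_within T alpha s /\ derivable_within T sigma s) ->
  set_inj T u -> set_inj T v ->
  T (t i) -> T (t i.+1) ->
  C2_within (segment ui ui1) xu xu1 xu2 ->
  C2_within (segment vi vi1) ev ev1 ev2 ->
  `|B| <= M ->
  segment ui ui1 `<=` `[- M, M] ->
  segment vi vi1 `<=` `[- M, M] ->
  (forall w, segment ui ui1 w ->
     [/\ enorm (xu w) <= M, enorm (xu1 w) <= M & enorm (xu2 w) <= M]) ->
  (forall w, segment vi vi1 w ->
     [/\ enorm (ev w) <= M, enorm (ev1 w) <= M & enorm (ev2 w) <= M]) ->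
  let x_exact :=
    A *: x (t i) +
    B *: (exact_term tau_u xu ui ui1 + exact_term tau_v ev vi vi1) in
  let x_corr :=
    A *: x (t i) +
    B *: (corr_term tau_u kappa_u xu ui ui1 +
          corr_term tau_v kappa_v ev vi vi1) in
  enorm (x_exact - x_corr) <= C * (`|ui1 - ui| ^+ 3 + `|vi1 - vi| ^+ 3).
Proof.
(* A negative [M] contradicts the bound on [B], so any constant serves. *)
have [M0|M0] := ltP M 0.
  exists 0 => d alpha sigma gamma T x_theta eps_theta x t i xu1 xu2 ev1 ev2.
  move=> u v ui ui1 vi vi1 xu ev A B _ _ _ _ _ _ _ _ _ BM.
  by have := le_lt_trans BM M0; rewrite normr_lt0.
pose C (tau kappa : R) := (expR (tau * M) * (1 + tau) + `|kappa|) / 2 * M.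
have C0 (tau kappa : R) : 0 < tau -> 0 <= C tau kappa.
  move=> tau0; rewrite !mulr_ge0// addr_ge0// mulr_ge0 ?expR_ge0// addr_ge0//.
  exact: ltW.
(* The factor [M] bounds [B]; the rest adds the constants of the two terms. *)
exists (M * (C tau_u kappa_u + C tau_v kappa_v)).
move=> d alpha sigma gamma T x_theta eps_theta x t i xu1 xu2 ev1 ev2.
move=> u v ui ui1 vi vi1 xu ev A B _ _ _ _ _ _ _ Cxu Cev BM uM vM xuM evM.
cbv zeta.
set diff := (X in enorm X).
(* The [A] parts cancel and the errors separate by variable. *)
have -> : diff =
    B *: ((exact_term tau_u xu ui ui1 - corr_term tau_u kappa_u xu ui ui1) +
          (exact_term tau_v ev vi vi1 - corr_term tau_v kappa_v ev vi vi1)).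
  by rewrite /diff opprD addrACA subrr add0r -scalerBr opprD addrACA.
rewrite enormZ -mulrA; apply: ler_pM => //; first exact: enorm_ge0.
apply: (le_trans (enormD _ _)); rewrite mulrDl; apply: lerD.
  apply: (@le_trans _ _ (C tau_u kappa_u * `|ui1 - ui| ^+ 3)).
    apply: term_error Cxu uM _ => // w wu; by have [] := xuM w wu.
  by rewrite ler_wpM2l ?C0// lerDl exprn_ge0.
apply: (@le_trans _ _ (C tau_v kappa_v * `|vi1 - vi| ^+ 3)).
  apply: term_error Cev vM _ => // w wv; by have [] := evM w wv.
by rewrite ler_wpM2l ?C0// lerDr exprn_ge0.
Qed.
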